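(* Let $n_L\ge 4$ and let $\mathbf{s}_1,\ldots,\mathbf{s}_{n_L}\in\mathbb{R}^3$ be fixed points (landmarks), at least four of which are noncoplanar. Consider the nonlinear system $$\dot{\mathbf{x}}_1=\mathbf{x}_2,\quad \dot{\mathbf{x}}_2=\mathbf{x}_3+\mathbf{u}(t),\quad \dot{\mathbf{x}}_3=\mathbf{0},\quad r_i(t)=\|\mathbf{s}_i-\mathbf{x}_1(t)\|,\ i=1,\ldots,n_L,$$ with $\mathbf{x}_1,\mathbf{x}_2,\mathbf{x}_3\in\mathbb{R}^3$, restricted to solutions for which there is $r_m>0$ with $r_m\le r_i(t)$ for all $i$ and all $t>t_0$. Then: (1) The nonlinear system is observable in the sense that, for $t_0<t_f$, given the output $\{\mathbf{y}(t),\ t\in[t_0,t_f]\}$ and the input $\{\mathbf{u}(t),\ t\in[t_0,t_f]\}$, the initial state $\mathbf{x}(t_0)=[\mathbf{x}_1^T(t_0)\ \mathbf{x}_2^T(t_0)\ \mathbf{x}_3^T(t_0)]^T$ is uniquely defined. (2) A state observer with globally asymptotically stable error dynamics for the augmented linear time-varying system described in the context (built with the input $\mathbf{u}$ and the ranges $r_i$ of the nonlinear system) is also a state observer for the nonlinear system, with globally asymptotically stable error dynamics.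
   Context: **Input and output.** The input $\mathbf{u}(t)\in\mathbb{R}^3$ is a known signal (say piecewise continuous). The output of the nonlinear system is $\mathbf{y}(t)\in\mathbb{R}^{n_L+n_L(n_L-1)/2}$, with $y_i(t)=r_i(t)$ for $i=1,\ldots,n_L$, followed by, for every pair $1\le i<j\le n_L$, the known quantity $$\frac{\|\mathbf{s}_i\|^2-\|\mathbf{s}_j\|^2}{r_i(t)+r_j(t)},$$ which along solutions of the nonlinear system equals $\frac{2(\mathbf{s}_i-\mathbf{s}_j)\cdot\mathbf{x}_1(t)}{r_i(t)+r_j(t)}+r_i(t)-r_j(t)$. **Augmented linear time-varying (LTV) system.** Fix a solution of the nonlinear system, with its input $\mathbf{u}(t)$ and ranges $r_i(t)$, regarded as known functions of time. The LTV system $\dot{\boldsymbol{x}}=\mathbf{A}(t)\boldsymbol{x}+\mathbf{B}\mathbf{u}(t)$, $\mathbf{y}=\mathbf{C}(t)\boldsymbol{x}$ has state $$\boldsymbol{x}=[\mathbf{x}_1^T\ \mathbf{x}_2^T\ \mathbf{x}_3^T\ x_4\ \ldots\ x_{n_L+7}]^T\in\mathbb{R}^{13+n_L},\qquad \mathbf{x}_1,\mathbf{x}_2,\mathbf{x}_3\in\mathbb{R}^3,$$ all components being independent state variables (no algebraic relation among them, or between them and the signals $r_i(t)$, is imposed), and dynamics $$\dot{\mathbf{x}}_1=\mathbf{x}_2,\qquad \dot{\mathbf{x}}_2=\mathbf{x}_3+\mathbf{u}(t),\qquad \dot{\mathbf{x}}_3=\mathbf{0},$$ $$\dot x_{3+i}=-\frac{\mathbf{s}_i^T\mathbf{x}_2}{r_i(t)}+\frac{x_{n_L+4}}{r_i(t)},\quad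 i=1,\ldots,n_L,$$ $$\dot x_{n_L+4}=\mathbf{u}^T(t)\mathbf{x}_1+x_{n_L+5},\quad \dot x_{n_L+5}=2\mathbf{u}^T(t)\mathbf{x}_2+3x_{n_L+6},\quad \dot x_{n_L+6}=\mathbf{u}^T(t)\mathbf{x}_3+x_{n_L+7},\quad \dot x_{n_L+7}=0 .$$ Its output consists of $y_i=x_{3+i}$, $i=1,\ldots,n_L$, followed by, for every pair $1\le i<j\le n_L$, $\frac{2(\mathbf{s}_i-\mathbf{s}_j)\cdot\mathbf{x}_1}{r_i(t)+r_j(t)}+x_{3+i}-x_{3+j}$. **Augmented state of a nonlinear solution.** To a solution $(\mathbf{x}_1,\mathbf{x}_2,\mathbf{x}_3)$ of the nonlinear system one associates the augmented state with the same $\mathbf{x}_1,\mathbf{x}_2,\mathbf{x}_3$ and $x_{3+i}=r_i$ ($i=1,\ldots,n_L$), $x_{n_L+4}=\mathbf{x}_1\cdot\mathbf{x}_2$, $x_{n_L+5}=\mathbf{x}_1\cdot\mathbf{x}_3+\|\mathbf{x}_2\|^2$, $x_{n_L+6}=\mathbf{x}_2\cdot\mathbf{x}_3$, $x_{n_L+7}=\|\mathbf{x}_3\|^2$. **State observers.** A state observer for the LTV system is a system $\dot{\hat{\boldsymbol{x}}}(t)=F(t,\hat{\boldsymbol{x}}(t),\mathbf{y}(t))$, where $F$ may depend on the known signals $\mathbf{u}$ and $r_i$. It has globally asymptotically stable (GAS) error dynamics if, whenever $\mathbf{y}$ is the output of a solution $\boldsymbol{x}$ of the LTV system on $[t_0,\infty)$,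 the error $\tilde{\boldsymbol{x}}=\boldsymbol{x}-\hat{\boldsymbol{x}}$ satisfies: for every $\tau\ge t_0$ and $\varepsilon>0$ there is $\delta>0$, independent of the solution $\boldsymbol{x}$, such that $\|\tilde{\boldsymbol{x}}(\tau)\|<\delta$ implies $\|\tilde{\boldsymbol{x}}(t)\|<\varepsilon$ for all $t\ge\tau$; and $\tilde{\boldsymbol{x}}(t)\to\mathbf{0}$ as $t\to\infty$ for every initial estimate $\hat{\boldsymbol{x}}(\tau)$. It is a state observer for the nonlinear system with GAS error dynamics if, when it is driven by the output $\mathbf{y}$ of the nonlinear system, the same two properties hold for the error $\tilde{\boldsymbol{x}}$ between the augmented state of the nonlinear solution and $\hat{\boldsymbol{x}}$; the first nine components of $\hat{\boldsymbol{x}}$ are then the estimate of $(\mathbf{x}_1,\mathbf{x}_2,\mathbf{x}_3)$, and they converge to it from any initial estimate. *)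

(* Defs.v *)
(* Signals are total functions of time; only their values on
   the time interval of interest are ever constrained. *)
From mathcomp Require Import all_boot all_order all_algebra.
From mathcomp Require Import all_classical all_reals all_analysis.
Set Implicit Arguments.
Unset Strict Implicit.
Unset Printing Implicit Defensive.
Import Order.TTheory GRing.Theory Num.Theory numFieldNormedType.Exports.
Local Open Scope classical_set_scope.
Local Open Scope ring_scope.

(* The library norm `|x| on 'rV[R]_n is the sup norm, hence [enorm]. *)
Definition dot {R : realType} {n : nat} (x y : 'rV[R]_n) : R :=
  \sum_k x 0 k * y 0 k.

Definition enorm {R : realType} {n : nat} (x : 'rV[R]_n) : R :=
  Num.sqrt (dot x x).

Definition coplanar {R : realType} {m : nat} (p : 'I_m -> 'rV[R]_3) : Prop :=
  exists (a : 'rV[R]_3) (b : R), a != 0 /\ forall k, dot a (p k) = b.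

Definition locally_finite {R : realType} (S : set R) : Prop :=
  forall a b : R, finite_set (S `&` `[a, b]).

Definition piecewise_continuous {R : realType} {n : nat} (t0 : R)
    (u : R -> 'rV[R]_n) : Prop :=
  [/\ exists2 S : set R, locally_finite S &
        forall t : R, t0 < t -> ~ S t -> {for t, continuous u},
      forall t : R, t0 <= t -> cvg (u @ t^'+)
    & forall t : R, t0 < t -> cvg (u @ t^'-)].

(* Solutions on [t0, +oo[ of x' = f(t, x) when f is only piecewise continuous in
   t: continuous (from the right at t0), and differentiable with the prescribed
   derivative except at a locally finite set of times, where the right-hand side
   may jump. *)
Definition is_solution {R : realType} {n : nat} (t0 : R)
    (f : R -> 'rV[R]_n -> 'rV[R]_n) (x : R -> 'rV[R]_n) : Prop :=
  {within `[t0, +oo[, continuous x} /\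
  exists2 S : set R, locally_finite S &
    forall t : R, t0 < t -> ~ S t -> is_derive t 1 x (f t (x t)).

Notation kin_dim := (3 + (3 + 3))%N.

Definition st1 {R : realType} (x : 'rV[R]_kin_dim) : 'rV[R]_3 := lsubmx x.
Definition st2 {R : realType} (x : 'rV[R]_kin_dim) : 'rV[R]_3 :=
  lsubmx (rsubmx x).
Definition st3 {R : realType} (x : 'rV[R]_kin_dim) : 'rV[R]_3 :=
  rsubmx (rsubmx x).

(* Augmented state: the nine components of (x_1, x_2, x_3), then
   x_4, ..., x_(nL+3), then x_(nL+4), ..., x_(nL+7), that is 13 + nL components.
   [aux z k] is x_(nL+4+k). *)
Notation aug_dim nL := (kin_dim + (nL + 4))%N.

Definition kin {R : realType} {nL : nat} (z : 'rV[R]_(aug_dim nL)) :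
  'rV[R]_kin_dim := lsubmx z.
Definition rng {R : realType} {nL : nat} (z : 'rV[R]_(aug_dim nL)) :
  'rV[R]_nL := lsubmx (rsubmx z).
Definition aux {R : realType} {nL : nat} (z : 'rV[R]_(aug_dim nL)) (k : nat) : R :=
  rsubmx (rsubmx z) 0 (inord k : 'I_4).

(* Outputs have nL + nL (nL - 1) / 2 components (see [card_pairs]): one per
   landmark, then one per pair i < j, in the order of the enumeration of
   [pairs nL]. *)
Definition pairs (nL : nat) : {set 'I_nL * 'I_nL} :=
  [set p : 'I_nL * 'I_nL | (p.1 < p.2)%N]%SET.

Notation out_dim nL := (nL + #|pairs nL|)%N.

Lemma card_pairs (nL : nat) : #|pairs nL| = (nL * (nL - 1) %/ 2)%N.
Proof.
rewrite subn1 divn2 -bin2 -bin2_sum /pairs -sum1_card.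
rewrite (eq_bigl (fun p : 'I_nL * 'I_nL => (p.1 < p.2)%N)); last first.
  by move=> p; rewrite inE.
rewrite -(pair_big_dep xpredT (fun i j : 'I_nL => (i < j)%N) (fun _ _ => 1%N)).
rewrite (exchange_big_dep xpredT) //= big_mkord; apply: eq_bigr => j _.
by rewrite -(big_ord_widen nL (fun=> 1%N)) ?sum1_card ?card_ord // ltnW.
Qed.

Section System.
Context {R : realType} {nL : nat}.
Variable s : 'I_nL -> 'rV[R]_3.

Definition pair_row (f : 'I_nL -> 'I_nL -> R) : 'rV[R]_#|pairs nL| :=
  \row_k f (enum_val k).1 (enum_val k).2.

Definition nl_field (u : R -> 'rV[R]_3) (t : R) (x : 'rV[R]_kin_dim) :
    'rV[R]_kin_dim :=
  row_mx (st2 x) (row_mx (st3 x + u t) 0).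

Definition ranges (x : R -> 'rV[R]_kin_dim) (t : R) : 'rV[R]_nL :=
  \row_i enorm (s i - st1 (x t)).

Definition nl_output (x : R -> 'rV[R]_kin_dim) (t : R) : 'rV[R]_(out_dim nL) :=
  let r := ranges x t in
  row_mx r (pair_row (fun i j =>
    (enorm (s i) ^+ 2 - enorm (s j) ^+ 2) / (r 0 i + r 0 j))).

Definition nl_solution (t0 : R) (u : R -> 'rV[R]_3)
    (x : R -> 'rV[R]_kin_dim) : Prop :=
  is_solution t0 (nl_field u) x /\
  exists2 rm : R, 0 < rm & forall i (t : R), t0 < t -> rm <= ranges x t 0 i.

Definition ltv_field (u : R -> 'rV[R]_3) (r : R -> 'rV[R]_nL) (t : R)
    (z : 'rV[R]_(aug_dim nL)) : 'rV[R]_(aug_dim nL) :=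
  let x1 := st1 (kin z) in let x2 := st2 (kin z) in let x3 := st3 (kin z) in
  row_mx (row_mx x2 (row_mx (x3 + u t) 0))
  (row_mx (\row_i (- (dot (s i) x2 / r t 0 i) + aux z 0 / r t 0 i))
          (\row_(k < 4) [:: dot (u t) x1 + aux z 1;
                            2 * dot (u t) x2 + 3 * aux z 2;
                            dot (u t) x3 + aux z 3;
                            0]`_k)).

Definition ltv_output (r : R -> 'rV[R]_nL) (t : R) (z : 'rV[R]_(aug_dim nL)) :
    'rV[R]_(out_dim nL) :=
  row_mx (rng z) (pair_row (fun i j =>
    2 * dot (s i - s j) (st1 (kin z)) / (r t 0 i + r t 0 j)
    + rng z 0 i - rng z 0 j)).

Definition augment (x : R -> 'rV[R]_kin_dim) (t : R) : 'rV[R]_(aug_dim nL) :=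
  let x1 := st1 (x t) in let x2 := st2 (x t) in let x3 := st3 (x t) in
  row_mx (x t)
  (row_mx (ranges x t)
          (\row_(k < 4) [:: dot x1 x2;
                            dot x1 x3 + enorm x2 ^+ 2;
                            dot x2 x3;
                            enorm x3 ^+ 2]`_k)).

(* [P z y]: z is a state trajectory on [t0, +oo[ to be estimated and y the output
   available to the observer z^' = F(t, z^, y(t)).  F is a function of t, so that
   it may depend on any known signal.  Every initial estimate is required to have
   an observer trajectory defined for all later times, which rules out observers
   that are GAS vacuously; trajectories need not be unique. *)
Definition GAS_observer (t0 : R)
    (P : (R -> 'rV[R]_(aug_dim nL)) -> (R -> 'rV[R]_(out_dim nL)) -> Prop)
    (F : R -> 'rV[R]_(aug_dim nL) -> 'rV[R]_(out_dim nL) -> 'rV[R]_(aug_dim nL)) :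
    Prop :=
  let traj tau y := is_solution tau (fun t zh => F t zh (y t)) in
  [/\ forall z y, P z y -> forall tau : R, t0 <= tau -> forall zh0,
        exists2 zh, traj tau y zh & zh tau = zh0,
      forall tau : R, t0 <= tau -> forall eps : R, 0 < eps ->
        exists2 delta : R, 0 < delta &
          forall z y, P z y -> forall zh, traj tau y zh ->
            enorm (z tau - zh tau) < delta ->
            forall t : R, tau <= t -> enorm (z t - zh t) < eps
    & forall z y, P z y -> forall tau : R, t0 <= tau -> forall zh, traj tau y zh ->
        enorm (z t - zh t) @[t --> +oo] --> (0 : R)].

Definition ltv_behaviour (t0 : R) (u : R -> 'rV[R]_3) (r : R -> 'rV[R]_nL)
    (z : R -> 'rV[R]_(aug_dim nL)) (y : R -> 'rV[R]_(out_dim nL)) : Prop :=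
  is_solution t0 (ltv_field u r) z /\
  forall t : R, t0 <= t -> y t = ltv_output r t (z t).

(* The known signals u and r are fixed, since the observer is built with them. *)
Definition nl_behaviour (t0 : R) (u : R -> 'rV[R]_3) (r : R -> 'rV[R]_nL)
    (z : R -> 'rV[R]_(aug_dim nL)) (y : R -> 'rV[R]_(out_dim nL)) : Prop :=
  exists x, [/\ nl_solution t0 u x,
    forall t : R, t0 <= t -> ranges x t = r t,
    forall t : R, t0 <= t -> z t = augment x t
  & forall t : R, t0 <= t -> y t = nl_output x t].

End System.

(* Main.v *)
Require Import Defs.
From mathcomp Require Import all_boot all_order all_algebra.
From mathcomp Require Import all_classical all_reals all_analysis.
From mathcomp Require Import ring lra.
Set Implicit Arguments.
Unset Strict Implicit.
Unset Printing Implicit Defensive.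
Import Order.TTheory GRing.Theory Num.Theory numFieldNormedType.Exports.
Local Open Scope classical_set_scope.
Local Open Scope ring_scope.

(** Both parts rest on the fact that the ranges to the landmarks linearise the
kinematics.

Observability: expanding the squares in |s_i - v| = |s_i - w| leaves
2 s_i . (v - w) = |v|^2 - |w|^2, whose right-hand side does not depend on i.
All landmarks then lie on one plane with normal v - w, so noncoplanarity forces
v = w ([ranges_inj]): the ranges determine the position at each time.  Two
solutions with the same output have therefore the same position on [t0, tf].
On a short interval to the right of t0, free of the jump times of both
solutions, differentiating twice gives the same velocities and, the inputs being
equal, the same third component; right-continuity carries the equality to t0
([kin_eq_initial]).

Observer: along a nonlinear solution, the products x1 . x2, x1 . x3 + |x2|^2,
x2 . x3, |x3|^2 and the ranges themselves satisfy exactly the linear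
time-varying equations ([is_derive_augment]), and the pairwise outputs agree by
(r_i - r_j)(r_i + r_j) = r_i^2 - r_j^2 ([nl_output_augment]).  So every
behaviour of the nonlinear system is a behaviour of the augmented system
([nl_behaviour_ltv]).  The error of the observer is required to be stable on all
behaviours of a class, a requirement inherited by any smaller class
([GAS_observer_sub]). *)

(** * Euclidean dot product and norm *)

Section Dot.
Context {R : realType} {n : nat}.
Implicit Types x y z : 'rV[R]_n.

Lemma dotC x y : dot x y = dot y x.
Proof. by apply: eq_bigr => k _; rewrite mulrC. Qed.

Lemma dotDl x y z : dot (x + y) z = dot x z + dot y z.
Proof. by rewrite -big_split; apply: eq_bigr => k _; rewrite mxE mulrDl. Qed.

Lemma dotNl x y : dot (- x) y = - dot x y.
Proof. by rewrite -sumrN; apply: eq_bigr => k _; rewrite mxE mulNr. Qed.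

Lemma dotDr x y z : dot x (y + z) = dot x y + dot x z.
Proof. by rewrite dotC dotDl !(dotC x). Qed.

Lemma dotNr x y : dot x (- y) = - dot x y.
Proof. by rewrite dotC dotNl dotC. Qed.

Lemma dot0r x : dot x 0 = 0.
Proof. by apply: big1 => k _; rewrite mxE mulr0. Qed.

Lemma dot_ge0 x : 0 <= dot x x.
Proof. by apply: sumr_ge0 => k _; rewrite -expr2 sqr_ge0. Qed.

Lemma enorm_ge0 x : 0 <= enorm x.
Proof. exact: sqrtr_ge0. Qed.

Lemma sqr_enorm x : enorm x ^+ 2 = dot x x.
Proof. by rewrite sqr_sqrtr ?dot_ge0. Qed.

Lemma sqr_enormB x y :
  enorm (x - y) ^+ 2 = enorm x ^+ 2 - 2 * dot x y + enorm y ^+ 2.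
Proof.
rewrite !sqr_enorm dotDl !dotDr !dotNl !dotNr (dotC y x); ring.
Qed.

End Dot.

(** * Derivatives of vector-valued functions *)

Section Derivatives.
Context {R : realType}.

Lemma is_derive_mxP {m n : nat} (M : R -> 'M[R]_(m, n)) (t : R)
    (D : 'M[R]_(m, n)) :
  is_derive t 1 M D <->
  forall i j, is_derive t 1 (fun t => M t i j) (D i j).
Proof.
split=> [[dM <-] i j|dM].
  by split; [exact: (derivable_mxP _ _ _).1 dM i j | rewrite derive_mx ?mxE].
have dM' : derivable M t 1 by apply/derivable_mxP => i j; case: (dM i j).
split=> //; rewrite derive_mx //; apply/matrixP => i j; rewrite mxE.
by case: (dM i j).
Qed.

Lemma is_derive_lsubmx {n1 n2 : nat} (M : R -> 'rV[R]_(n1 + n2)) (t : R)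
    (D : 'rV[R]_(n1 + n2)) :
  is_derive t 1 M D -> is_derive t 1 (fun t => lsubmx (M t)) (lsubmx D).
Proof.
move=> /is_derive_mxP dM; apply/is_derive_mxP => i j; rewrite mxE.
by under eq_fun do rewrite mxE; exact: dM.
Qed.

Lemma is_derive_rsubmx {n1 n2 : nat} (M : R -> 'rV[R]_(n1 + n2)) (t : R)
    (D : 'rV[R]_(n1 + n2)) :
  is_derive t 1 M D -> is_derive t 1 (fun t => rsubmx (M t)) (rsubmx D).
Proof.
move=> /is_derive_mxP dM; apply/is_derive_mxP => i j; rewrite mxE.
by under eq_fun do rewrite mxE; exact: dM.
Qed.

Lemma is_derive_row_mx {n1 n2 : nat} (M : R -> 'rV[R]_n1) (N : R -> 'rV[R]_n2)
    (t : R) (D : 'rV[R]_n1) (E : 'rV[R]_n2) :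
  is_derive t 1 M D -> is_derive t 1 N E ->
  is_derive t 1 (fun t => row_mx (M t) (N t)) (row_mx D E).
Proof.
move=> /is_derive_mxP dM /is_derive_mxP dN; apply/is_derive_mxP => i j.
case: (split_ordP j) => k ->; rewrite ?row_mxEl ?row_mxEr.
  by under eq_fun do rewrite row_mxEl; exact: dM.
by under eq_fun do rewrite row_mxEr; exact: dN.
Qed.

Lemma is_derive_dot {n : nat} (f g : R -> 'rV[R]_n) (t : R)
    (df dg : 'rV[R]_n) :
  is_derive t 1 f df -> is_derive t 1 g dg ->
  is_derive t 1 (fun t => dot (f t) (g t)) (dot (f t) dg + dot df (g t)).
Proof.
move=> /is_derive_mxP dF /is_derive_mxP dG.
have -> : (fun t => dot (f t) (g t)) =
    \sum_(k < n) ((fun t => f t 0 k) * (fun t => g t 0 k)).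
  by apply/funext => x; rewrite fct_sumE.
apply: (is_derive_eq (is_derive_sum (fun k => is_deriveM (dF 0 k) (dG 0 k)))).
by rewrite big_split; congr (_ + _); apply: eq_bigr => k _;
  rewrite /GRing.scale /= // mulrC.
Qed.

Lemma is_derive_enorm {n : nat} (f : R -> 'rV[R]_n) (t : R) (df : 'rV[R]_n) :
  0 < enorm (f t) -> is_derive t 1 f df ->
  is_derive t 1 (fun t => enorm (f t)) (dot (f t) df / enorm (f t)).
Proof.
move=> f0 dF.
have ft0 : 0 < dot (f t) (f t) by rewrite -sqr_enorm exprn_gt0.
have /is_derive_eq := is_derive1_comp (f := Num.sqrt)
  (g := fun t => dot (f t) (f t)) (is_derive1_sqrt ft0) (is_derive_dot dF dF).
apply; rewrite (dotC df) -/(enorm (f t)).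
by field; rewrite gt_eqF.
Qed.

(** Functions that agree on an open interval may have derivatives prescribed by
different equations; this is how an equality of positions is turned into one of
velocities, and then of accelerations. *)
Lemma is_derive_unique_itv {V : normedModType R} (f g : R -> V) (a b t : R)
    (df dg : V) :
  t \in `]a, b[ -> {in `]a, b[, f =1 g} ->
  is_derive t 1 f df -> is_derive t 1 g dg -> df = dg.
Proof.
move=> tab fg dF dG; have [_ <-] := dG.
suff [_ <-] : is_derive t 1 g df by [].
apply: near_eq_is_derive dF; apply: filterS (near_in_itvoo tab).
exact: fg.
Qed.

End Derivatives.

(** * Limits of vector-valued functions *)

Section Limits.
Context {R : realType} {T : Type} {F : set_system T} {FF : Filter F}.

Lemma cvg_mxP {m n : nat} (M : T -> 'M[R]_(m, n)) (A : 'M[R]_(m, n)) :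
  M t @[t --> F] --> A <-> forall i j, M t i j @[t --> F] --> A i j.
Proof.
split=> [MA i j|MA].
  exact: (cvg_comp _ _ MA (@coord_continuous R m n i j A)).
apply/cvg_ballP => e e0; near=> t.
split=> // i j; move: i j; near: t.
apply: filter_forall => i; apply: filter_forall => j.
exact: (cvg_ballP _ _).1 (MA i j) e e0.
Unshelve. all: by end_near. Qed.

Lemma cvg_lsubmx {n1 n2 : nat} (M : T -> 'rV[R]_(n1 + n2))
    (A : 'rV[R]_(n1 + n2)) :
  M t @[t --> F] --> A -> lsubmx (M t) @[t --> F] --> lsubmx A.
Proof.
move=> /cvg_mxP MA; apply/cvg_mxP => i j; rewrite mxE.
by under eq_fun do rewrite mxE; exact: MA.
Qed.

Lemma cvg_rsubmx {n1 n2 : nat} (M : T -> 'rV[R]_(n1 + n2))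
    (A : 'rV[R]_(n1 + n2)) :
  M t @[t --> F] --> A -> rsubmx (M t) @[t --> F] --> rsubmx A.
Proof.
move=> /cvg_mxP MA; apply/cvg_mxP => i j; rewrite mxE.
by under eq_fun do rewrite mxE; exact: MA.
Qed.

Lemma cvg_row_mx {n1 n2 : nat} (M : T -> 'rV[R]_n1) (N : T -> 'rV[R]_n2)
    (A : 'rV[R]_n1) (B : 'rV[R]_n2) :
  M t @[t --> F] --> A -> N t @[t --> F] --> B ->
  row_mx (M t) (N t) @[t --> F] --> row_mx A B.
Proof.
move=> /cvg_mxP MA /cvg_mxP NB; apply/cvg_mxP => i j.
case: (split_ordP j) => k ->; rewrite ?row_mxEl ?row_mxEr.
  by under eq_fun do rewrite row_mxEl; exact: MA.
by under eq_fun do rewrite row_mxEr; exact: NB.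
Qed.

Lemma cvg_dot {n : nat} (f g : T -> 'rV[R]_n) (a b : 'rV[R]_n) :
  f t @[t --> F] --> a -> g t @[t --> F] --> b ->
  dot (f t) (g t) @[t --> F] --> dot a b.
Proof.
move=> /cvg_mxP fa /cvg_mxP gb.
apply: (cvg_big (op := +%R)); first exact: add_continuous.
by move=> k _; apply: cvgM.
Qed.

Lemma cvg_enorm {n : nat} (f : T -> 'rV[R]_n) (a : 'rV[R]_n) :
  f t @[t --> F] --> a -> enorm (f t) @[t --> F] --> enorm a.
Proof.
by move=> fa; exact: (cvg_comp _ _ (cvg_dot fa fa) (@sqrt_continuous R _)).
Qed.

End Limits.

(** * Uniqueness of the initial state *)

(** The point a itself may belong to S, hence the punctured set S' below, which
is finite and so closed. *)
Lemma locally_finite_near_right {R : realType} (S : set R) (a : R) :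
  locally_finite S -> \forall t \near a^'+, ~ S t.
Proof.
move=> /(_ a (a + 1)) finS.
pose S' := (S `&` `[a, a + 1]) `\ a.
have clS' : closed S'.
  apply: (accessible_finite_set_closed.1 _); last exact: finite_setD.
  exact/hausdorff_accessible/norm_hausdorff.
have S'a : nbhs a (~` S').
  by apply: open_nbhs_nbhs; split; [exact: closed_openC | case=> _ /=; apply].
near=> t => St.
have : ~ S' t by near: t; exact: cvg_within.
apply; split; last by apply/eqP; rewrite gt_eqF.
split=> //=; rewrite in_itv/=; apply/andP; split; apply/ltW => //.
by near: t; apply: nbhs_right_lt; rewrite ltrDl.
Unshelve. all: by end_near. Qed.

Section Kinematics.
Context {R : realType}.

Lemma kin_eq (v w : 'rV[R]_kin_dim) :
  st1 v = st1 w -> st2 v = st2 w -> st3 v = st3 w -> v = w.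
Proof.
move=> e1 e2 e3; rewrite -(hsubmxK v) -(hsubmxK w).
rewrite -(hsubmxK (rsubmx v)) -(hsubmxK (rsubmx w)).
by move: e1 e2 e3; rewrite /st1 /st2 /st3 => -> -> ->.
Qed.

Lemma is_derive_kin (u : R -> 'rV[R]_3) (x : R -> 'rV[R]_kin_dim) (t : R) :
  is_derive t 1 x (nl_field u t (x t)) ->
  [/\ is_derive t 1 (fun t => st1 (x t)) (st2 (x t)),
      is_derive t 1 (fun t => st2 (x t)) (st3 (x t) + u t)
    & is_derive t 1 (fun t => st3 (x t)) (0 : 'rV[R]_3)].
Proof.
move=> dx.
have := is_derive_lsubmx dx; rewrite /nl_field row_mxKl => dx1.
have := is_derive_rsubmx dx; rewrite /nl_field row_mxKr => dx23.
have := is_derive_lsubmx dx23; rewrite row_mxKl => dx2.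
by have := is_derive_rsubmx dx23; rewrite row_mxKr.
Qed.

(** The equations do not reach t0, where a solution is only right-continuous, so
the components are compared on an interval ]t0, t0 + e[ on which both equations
hold everywhere, and the equality is recovered at t0 as a right limit. *)
Lemma kin_eq_initial (t0 tf : R) (u u' : R -> 'rV[R]_3)
    (x x' : R -> 'rV[R]_kin_dim) :
  t0 < tf ->
  is_solution t0 (nl_field u) x -> is_solution t0 (nl_field u') x' ->
  (forall t, t0 <= t <= tf -> u t = u' t) ->
  (forall t, t0 <= t <= tf -> st1 (x t) = st1 (x' t)) ->
  x t0 = x' t0.
Proof.
move=> t0f [cx [S lfS dx]] [cx' [S' lfS' dx']] uu' x1.
suff xx' : \forall t \near t0^'+, x t = x' t.
  have [_ cx0] := (continuous_within_itvcyP _ _).1 cx.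
  have [_ cx'0] := (continuous_within_itvcyP _ _).1 cx'.
  apply: (cvg_unique _ cx0); first exact: norm_hausdorff.
  apply: cvg_trans cx'0; apply: near_eq_cvg.
  by near do apply/esym.
have : \forall t \near t0^'+, [/\ ~ S t, ~ S' t & t < tf].
  near=> t; split; near: t; [exact: locally_finite_near_right..|].
  exact: nbhs_right_lt.
rewrite {1}/at_right near_withinE => /nbhs_ballP[e /= e0 he].
have ok t : t \in `]t0, (t0 + e)[ -> [/\ t0 < t, ~ S t, ~ S' t & t0 <= t <= tf].
  rewrite in_itv/= => /andP[t0t te].
  have [] // := he t.
    by rewrite /ball/= distrC gtr0_norm ?subr_gt0 // ltrBlDl.
  by move=> St S't /ltW ttf; split => //; rewrite (ltW t0t).
have dkin t : t \in `]t0, (t0 + e)[ ->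
    is_derive t 1 x (nl_field u t (x t)) /\
    is_derive t 1 x' (nl_field u' t (x' t)).
  by move=> /ok[t0t St S't _]; split; [exact: dx|exact: dx'].
have e1 : {in `]t0, (t0 + e)[, (fun t => st1 (x t)) =1 (fun t => st1 (x' t))}.
  by move=> t /ok[_ _ _ /x1].
have e2 : {in `]t0, (t0 + e)[, (fun t => st2 (x t)) =1 (fun t => st2 (x' t))}.
  move=> t tI.
  have [/is_derive_kin[d1 _ _] /is_derive_kin[d1' _ _]] := dkin t tI.
  exact: is_derive_unique_itv tI e1 d1 d1'.
have e3 : {in `]t0, (t0 + e)[, (fun t => st3 (x t)) =1 (fun t => st3 (x' t))}.
  move=> t tI.
  have [/is_derive_kin[_ d2 _] /is_derive_kin[_ d2' _]] := dkin t tI.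
  have := is_derive_unique_itv tI e2 d2 d2'.
  by have [_ _ _ /uu' ->] := ok t tI => /addIr.
near=> t; have tI : t \in `]t0, (t0 + e)[.
  rewrite in_itv/=; apply/andP; split => //.
  by near: t; apply: nbhs_right_lt; rewrite ltrDl.
by apply: kin_eq; [exact: e1|exact: e2|exact: e3].
Unshelve. all: by end_near. Qed.

End Kinematics.

(** Otherwise v - w would be the normal of a plane containing all the p k, because
the square norm of p k cancels in the difference of the squared distances. *)
Lemma ranges_inj {R : realType} {m : nat} (p : 'I_m -> 'rV[R]_3)
    (v w : 'rV[R]_3) :
  ~ coplanar p -> (forall k, enorm (p k - v) = enorm (p k - w)) -> v = w.
Proof.
move=> hp hr; apply/eqP; rewrite -subr_eq0; apply: contra_notT hp => vw.
exists (v - w), ((enorm v ^+ 2 - enorm w ^+ 2) / 2); split => // k.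
have := congr1 (fun r => r ^+ 2) (hr k).
rewrite !sqr_enormB dotDl dotNl (dotC v) (dotC w).
lra.
Qed.

(** * The augmented state solves the linear time-varying system *)

Section Augmented.
Context {R : realType} {nL : nat} (s : 'I_nL -> 'rV[R]_3).

(** The behaviour occurs in the definition only as a hypothesis, and the delta of
the stability clause is chosen uniformly over it. *)
Lemma GAS_observer_sub (t0 : R) (P Q : (R -> 'rV[R]_(aug_dim nL)) ->
    (R -> 'rV[R]_(out_dim nL)) -> Prop) F :
  (forall z y, Q z y -> P z y) -> GAS_observer t0 P F -> GAS_observer t0 Q F.
Proof.
move=> QP [ex st at_]; split.
- by move=> z y /QP; exact: ex.
- move=> tau h eps e0; have [d d0 hd] := st tau h eps e0.
  by exists d => // z y /QP; exact: hd.
- by move=> z y /QP; exact: at_.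
Qed.

Lemma rng_augment x t : rng (augment s x t) = ranges s x t.
Proof. by rewrite /rng /augment row_mxKr row_mxKl. Qed.

Lemma kin_augment x t : kin (augment s x t) = x t.
Proof. by rewrite /kin /augment row_mxKl. Qed.

Lemma nl_output_augment x t :
  nl_output s x t = ltv_output s (ranges s x) t (augment s x t).
Proof.
rewrite /nl_output /ltv_output rng_augment kin_augment; congr row_mx.
apply/rowP => k; rewrite !mxE; set i := (enum_val k).1; set j := (enum_val k).2.
set v := st1 (x t).
have := sqr_enormB (s i) v; have := sqr_enormB (s j) v.
rewrite dotDl dotNl.
have := enorm_ge0 (s i - v); have := enorm_ge0 (s j - v).
move: (enorm (s i - v)) (enorm (s j - v)) => a b b0 a0 eb ea.
have [ab|ab] := eqVneq (a + b) 0.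
  (* Nonnegative ranges with zero sum both vanish, and so do both quotients,
     since the inverse of zero is zero. *)
  rewrite ab invr0 !mulr0; lra.
apply: (mulIf ab); rewrite !mulrDl !mulNr !divfK //.
lra.
Qed.

Lemma cvg_augment {F : set_system R} {FF : Filter F}
    (x : R -> 'rV[R]_kin_dim) (t : R) :
  x t @[t --> F] --> x t -> augment s x t @[t --> F] --> augment s x t.
Proof.
move=> cx.
have c1 : st1 (x t) @[t --> F] --> st1 (x t) by exact: (cvg_lsubmx cx).
have c23 : rsubmx (x t) @[t --> F] --> rsubmx (x t).
  exact: (cvg_rsubmx cx).
have c2 : st2 (x t) @[t --> F] --> st2 (x t) by exact: (cvg_lsubmx c23).
have c3 : st3 (x t) @[t --> F] --> st3 (x t) by exact: (cvg_rsubmx c23).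
apply: cvg_row_mx => //; apply: cvg_row_mx; apply/cvg_mxP => i k.
  under eq_fun do rewrite mxE.
  by rewrite mxE; apply: cvg_enorm; apply: cvgB => //; exact: cvg_cst.
under eq_fun do rewrite mxE.
rewrite mxE; case: k => -[|[|[|[|//]]]] /= _.
- exact: cvg_dot.
- apply: cvgD; first exact: cvg_dot.
  by apply: cvgM; exact: cvg_enorm.
- exact: cvg_dot.
- by apply: cvgM; exact: cvg_enorm.
Qed.

(** The range to s_i has derivative (x1 - s_i) . x2 / r_i; the product x1 . x2 in
it is the state variable that makes this linear.  The further variables come from
differentiating x1 . x2 repeatedly, which closes up at |x3|^2 because x3 is
constant.  Positivity of the ranges is what makes them differentiable. *)
Lemma is_derive_augment u x t : (forall i, 0 < ranges s x t 0 i) ->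
  is_derive t 1 x (nl_field u t (x t)) ->
  is_derive t 1 (augment s x) (ltv_field s u (ranges s x) t (augment s x t)).
Proof.
move=> r0 dx; have [d1 d2 d3] := is_derive_kin dx.
rewrite /ltv_field kin_augment.
apply: is_derive_row_mx => //.
apply: is_derive_row_mx; apply/is_derive_mxP => i k.
  have rk : 0 < enorm (s k - st1 (x t)) by have := r0 k; rewrite mxE.
  under eq_fun do rewrite mxE.
  have dk := is_deriveB (is_derive_cst (s k) t 1) d1.
  apply: (is_derive_eq (is_derive_enorm rk dk)).
  rewrite !mxE /aux /augment !row_mxKr mxE inordK //=.
  by rewrite sub0r dotNr dotDl dotNl opprD opprK mulrDl mulNr.
under eq_fun do rewrite mxE.
rewrite /aux /augment !row_mxKr !mxE !inordK //=.
case: k => -[|[|[|[|//]]]] /= _.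
- apply: (is_derive_eq (is_derive_dot d1 d2)).
  rewrite sqr_enorm dotDr (dotC (u t)); ring.
- under eq_fun do rewrite sqr_enorm.
  have d := is_deriveD (is_derive_dot d1 d3) (is_derive_dot d2 d2).
  apply: (is_derive_eq d).
  rewrite dot0r dotDr dotDl (dotC (u t)) (dotC (st3 _)); ring.
- apply: (is_derive_eq (is_derive_dot d2 d3)).
  by rewrite dot0r add0r dotDl sqr_enorm addrC.
- under eq_fun do rewrite sqr_enorm.
  apply: (is_derive_eq (is_derive_dot d3 d3)).
  by rewrite (dotC 0) dot0r addr0.
Qed.

(** The trajectory z and the ranges r are prescribed from t0 on only, so z is
replaced by the augmented state near times t > t0 before it is differentiated. *)
Lemma nl_behaviour_ltv t0 u r z y :
  nl_behaviour s t0 u r z y -> ltv_behaviour s t0 u r z y.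
Proof.
move=> [x [[[cx [S lfS dx]] [rm rm0 hr]] xr zx yx]].
split; last first.
  move=> t t0t; rewrite yx // zx // nl_output_augment /ltv_output.
  by rewrite xr.
split.
  apply: (@subspace_eq_continuous _ _ _ (augment s x)).
    by move=> t; rewrite inE/= in_itv/= andbT => /zx.
  apply/subspace_continuousP => t tt0; apply: cvg_augment.
  exact: (subspace_continuousP _ _).1 cx t tt0.
exists S => // t t0t St; rewrite zx; last exact: ltW.
apply: (@near_eq_is_derive _ _ _ (augment s x)).
  by near=> v; rewrite zx //; apply: ltW; near: v; exact: lt_nbhsr.
have -> : ltv_field s u r t (augment s x t) =
    ltv_field s u (ranges s x) t (augment s x t).
  by rewrite /ltv_field xr ?ltW.
apply: is_derive_augment; last exact: dx.
by move=> i; apply: lt_le_trans (hr i t t0t).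
Unshelve. all: by end_near. Qed.

End Augmented.

(** * Observability and transfer of observers *)

Theorem theorem2 (R : realType) (nL : nat) (hnL : (4 <= nL)%N)
    (s : 'I_nL -> 'rV[R]_3)
    (hs : exists c : 'I_4 -> 'I_nL, ~ coplanar (fun k => s (c k)))
    (t0 : R) :
  (forall (tf : R), t0 < tf ->
   forall (u u' : R -> 'rV[R]_3) (x x' : R -> 'rV[R]_kin_dim),
     piecewise_continuous t0 u -> piecewise_continuous t0 u' ->
     nl_solution s t0 u x -> nl_solution s t0 u' x' ->
     (forall t : R, t0 <= t <= tf -> u t = u' t) ->
     (forall t : R, t0 <= t <= tf -> nl_output s x t = nl_output s x' t) ->
     x t0 = x' t0)
  /\
  (forall (u : R -> 'rV[R]_3) (x : R -> 'rV[R]_kin_dim),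
     piecewise_continuous t0 u ->
     nl_solution s t0 u x ->
     forall F : R -> 'rV[R]_(aug_dim nL) -> 'rV[R]_(out_dim nL) ->
                'rV[R]_(aug_dim nL),
       GAS_observer t0 (ltv_behaviour s t0 u (ranges s x)) F ->
       GAS_observer t0 (nl_behaviour s t0 u (ranges s x)) F).
Proof.
split=> [tf t0f u u' x x' _ _ [sx _] [sx' _] uu' yy'|u x _ _ F].
  have [c hc] := hs.
  apply: (kin_eq_initial t0f sx sx' uu') => t tI.
  apply: (ranges_inj hc) => k.
  have /eq_row_mx[/rowP/(_ (c k)) + _] := yy' t tI.
  by rewrite !mxE.
by apply: GAS_observer_sub => z y; exact: nl_behaviour_ltv.
Qed.
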